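(* Assume that the discrete mass balance over the dual cells holds, i.e. for all $\sigma\in\mathcal{E}$ and all $0\le n\le N-1$, $$\frac{|D_\sigma|}{\delta t}\bigl(\rho_{D_\sigma}^{n+1}-\rho_{D_\sigma}^n\bigr)+\sum_{\epsilon\in\tilde{\mathcal{E}}(D_\sigma)}F_{\sigma,\epsilon}^n=0 .$$ Then, for all $1\le i\le d$, $\sigma\in\mathcal{E}$ and $0\le n\le N-1$, $$|D_\sigma|\,u_{i,\sigma}^{n+1}\,C(\rho,u)_{\sigma,i}^{n+1}=\frac{|D_\sigma|}{2\,\delta t}\Bigl(\rho_{D_\sigma}^{n+1}(u_{i,\sigma}^{n+1})^2-\rho_{D_\sigma}^{n}(u_{i,\sigma}^{n})^2\Bigr)+\frac12\sum_{\epsilon\in\tilde{\mathcal{E}}(D_\sigma)}F_{\sigma,\epsilon}^n\,(u_{i,\epsilon}^n)^2+\sum_{\epsilon\in\tilde{\mathcal{E}}(D_\sigma)}T_{\sigma,\epsilon,i}^{n+1}+R_{\sigma,i}^{n+1},$$ with $$T_{\sigma,\epsilon,i}^{n+1}=-\frac12\,F_{\sigma,\epsilon}^n\,(u_{i,\epsilon}^n-u_{i,\sigma}^n)^2,$$ $$R_{\sigma,i}^{n+1}=\frac{|D_\sigma|}{2\,\delta t}\,\rho_{D_\sigma}^{n+1}\bigl(u_{i,\sigma}^{n+1}-u_{i,\sigma}^n\bigr)^2+(u_{i,\sigma}^{n+1}-u_{i,\sigma}^n)\sum_{\epsilon\in\tilde{\mathcal{E}}(D_\sigma)}F_{\sig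ma,\epsilon}^n\,(u_{i,\epsilon}^n-u_{i,\sigma}^n).$$
   Context: Mesh. Let $d\in\{2,3\}$ and let $\Omega\subset\mathbb{R}^d$ be split into a finite family $\mathcal{M}$ of disjoint quadrangles ($d=2$) or hexahedra ($d=3$) $K$, the primal cells. $\mathcal{E}$ is the finite set of faces of the mesh and $\mathcal{E}(K)$ the set of faces of $K$. A face is internal if it separates two cells $K\neq L$ (one writes $\sigma=K|L$), and external if it lies on $\partial\Omega$. Each cell $K$ is split into sub-cells $D_{K,\sigma}$, $\sigma\in\mathcal{E}(K)$, with measures $|D_{K,\sigma}|>0$ (if $K$ is a rectangle or a rectangular cuboid, $D_{K,\sigma}$ is the cone with basis $\sigma$ and vertex the mass center of $K$; for a general cell, the splitting has the same number of sub-cells and the same connectivity). The dual cell of $\sigma$ is $D_\sigma=D_{K,\sigma}\cup D_{L,\sigma}$ if $\sigma=K|L$ is internal, and $D_\sigma=D_{K,\sigma}$ if $\sigma\in\mathcal{E}(K)$ is external; $|D_\sigma|>0$ is its measure. $\tilde{\mathcal{E}}(D_\sigma)$ is the finite set of dual faces $\epsilon$ of $D_\sigma$. Time discretization. $\delta t=T/N>0$ is a constant time step; the superscript $n$, $0\le n\le N$, denotes values at time $t_n=n\,\delta t$. Discrete unknowns. The densities $\rho_K^n>0$ are attached to the primal cells, and the velocity components $u_{\sigma,i}^n=u_{i,\sigma}^n\in\mathbb{R}$ (both notations are used), $1\le i\le d$, are attached to the faces $\sigma\in\mathcal{E}$. The face densities are defined by $|D_\sigma|\,\rho_{D_\sigma}^n=|D_{K,\sigma}|\,\rho_K^n+|D_{L,\sigma}|\,\rho_L^n$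 for $\sigma=K|L$ internal, and $\rho_{D_\sigma}^n=\rho_K^n$ for $\sigma$ an external face of $K$. $F_{\sigma,\epsilon}^n\in\mathbb{R}$ is the mass flux through the dual face $\epsilon$ outward $D_\sigma$. $u_{i,\epsilon}^n\in\mathbb{R}$ is an approximation of the $i$-th velocity component on the dual face $\epsilon$ at time $t_n$; its expression is not specified (it may be any real number). Discrete convection operator. For $1\le i\le d$ and $\sigma\in\mathcal{E}$, $$C(\rho,u)_{\sigma,i}^{n+1}=\frac1{\delta t}\bigl(\rho_{D_\sigma}^{n+1}u_{\sigma,i}^{n+1}-\rho_{D_\sigma}^{n}u_{\sigma,i}^{n}\bigr)+\frac1{|D_\sigma|}\sum_{\epsilon\in\tilde{\mathcal{E}}(D_\sigma)}F_{\sigma,\epsilon}^n\,u_{\epsilon,i}^n,\qquad u_{\epsilon,i}^n=u_{i,\epsilon}^n .$$ *)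

(* Defs.v *)
From HB Require Import structures.
From mathcomp Require Import all_boot all_order all_algebra.
From mathcomp Require Import all_classical all_reals all_analysis.
Import Order.TTheory GRing.Theory Num.Theory.
Import numFieldNormedType.Exports.

Set Implicit Arguments.
Unset Strict Implicit.
Unset Printing Implicit Defensive.

Local Open Scope classical_set_scope.
Local Open Scope ring_scope.

Section Volume.
Context {R : realType} {d : nat}.
Implicit Types (a b : 'rV[R]_d) (A : set 'rV[R]_d).

Definition box a b : set 'rV[R]_d :=
  [set x | forall i, a 0 i < x 0 i <= b 0 i].

Definition box_volume a b : R := \prod_(i < d) Num.max 0 (b 0 i - a 0 i).

(* The library has no Lebesgue measure on 'rV[R]_d: this is the Lebesgue outer
   measure, which coincides with it on measurable sets. *)
Definition lebesgue_outer A : \bar R :=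
  ereal_inf [set (\sum_(0 <= k <oo) (box_volume (ab k).1 (ab k).2)%:E)%E
            | ab in [set ab : nat -> 'rV[R]_d * 'rV[R]_d |
                     A `<=` \bigcup_k box (ab k).1 (ab k).2]].

Definition volume A : R := fine (lebesgue_outer A).

Definition boundary A : set 'rV[R]_d := closure A `\` interior A.

(* A is, up to its boundary, the rectangle (cuboid) with center c and with the
   rows of V, pairwise orthogonal, as half-edges. *)
Definition is_cuboid A (c : 'rV[R]_d) (V : 'M[R]_d) : Prop :=
  [/\ forall i, row i V != 0,
      forall i j, i != j -> row i V *m (row j V)^T = 0
    & closure A = [set x | exists2 t : 'rV[R]_d,
                     forall i, -1 <= t 0 i <= 1 & x = c + t *m V]].

Definition cone A (c : 'rV[R]_d) : set 'rV[R]_d :=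
  [set y | exists t x, [/\ 0 <= t <= 1, A x & y = c + t *: (x - c)]].

End Volume.

Record mesh_data (R : realType) (d : nat) := MeshData {
  domain : set 'rV[R]_d;
  cell : finType;
  face : finType;
  dual_face : finType;
  cell_set : cell -> set 'rV[R]_d;
  face_set : face -> set 'rV[R]_d;
  faces : cell -> {set face};
  subcell : cell -> face -> set 'rV[R]_d; (* relevant for s \in faces K *)
  dual_faces : face -> {set dual_face}
}.

Section Mesh.
Context {R : realType} {d : nat} (M : mesh_data R d).
Implicit Types (K L : cell M) (s : face M).

Definition internal_face s K L : Prop :=
  [/\ K != L, s \in faces K & s \in faces L].

Definition external_face s K : Prop :=
  s \in faces K /\ face_set s `<=` boundary (domain M).

(* This is D_{K,s} `|` D_{L,s} if s = K|L, and D_{K,s} if s is external. *)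
Definition dual_cell s : set 'rV[R]_d :=
  \bigcup_(K in [set K | s \in faces K]) subcell K s.

Definition subcell_vol K s : R := volume (subcell K s).

Definition dual_vol s : R := volume (dual_cell s).

(* Cells, faces and sub-cells may be taken open or closed: covering conditions
   are up to closure, and disjointness is that of the interiors. *)
Record is_mesh : Prop := IsMesh {
  cells_cover :
    closure (domain M) = \bigcup_(K in [set: cell M]) closure (cell_set K);
  cells_disjoint : forall K L, K != L ->
    interior (cell_set K) `&` interior (cell_set L) = set0;
  (* quadrangles if d = 2, hexahedra if d = 3 *)
  card_faces : forall K, #|faces K| = (2 * d)%N;
  faces_boundary : forall K,
    boundary (cell_set K) =
      \bigcup_(s in [set s | s \in faces K]) closure (face_set s);
  face_cases : forall s,
    (exists K L, internal_face s K L) \/ (exists K, external_face s K);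
  internal_cells : forall s K L K', internal_face s K L ->
    s \in faces K' -> K' = K \/ K' = L;
  external_cell : forall s K K', external_face s K ->
    s \in faces K' -> K' = K;
  subcells_cover : forall K,
    closure (cell_set K) =
      \bigcup_(s in [set s | s \in faces K]) closure (subcell K s);
  subcells_disjoint : forall K s s', s \in faces K -> s' \in faces K ->
    s != s' -> interior (subcell K s) `&` interior (subcell K s') = set0;
  subcells_cuboid : forall K c V, is_cuboid (cell_set K) c V ->
    forall s, s \in faces K ->
    closure (subcell K s) = cone (closure (face_set s)) c;
  subcell_vol_gt0 : forall K s, s \in faces K -> 0 < subcell_vol K s;
  dual_vol_gt0 : forall s, 0 < dual_vol s
}.

Definition is_face_density (rho : cell M -> R) (rhoD : face M -> R) : Prop :=
  (forall s K L, internal_face s K L ->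
     dual_vol s * rhoD s = subcell_vol K s * rho K + subcell_vol L s * rho L) /\
  (forall s K, external_face s K -> rhoD s = rho K).

Section Scheme.
Variables (dt : R) (rhoD : nat -> face M -> R).
Variables (u : nat -> 'I_d -> face M -> R).
Variables (F : nat -> face M -> dual_face M -> R).
Variables (ue : nat -> 'I_d -> dual_face M -> R).

Definition dual_mass_balance (n : nat) s : Prop :=
  dual_vol s / dt * (rhoD n.+1 s - rhoD n s)
    + \sum_(e in dual_faces s) F n s e = 0.

(* In the three definitions below, the value at n is the quantity with
   superscript n+1. *)
Definition convection (n : nat) (i : 'I_d) s : R :=
  dt^-1 * (rhoD n.+1 s * u n.+1 i s - rhoD n s * u n i s)
    + (dual_vol s)^-1 * \sum_(e in dual_faces s) F n s e * ue n i e.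

Definition flux_remainder (n : nat) (i : 'I_d) s (e : dual_face M) : R :=
  - 2^-1 * F n s e * (ue n i e - u n i s) ^+ 2.

Definition time_remainder (n : nat) (i : 'I_d) s : R :=
  dual_vol s / (2 * dt) * rhoD n.+1 s * (u n.+1 i s - u n i s) ^+ 2
    + (u n.+1 i s - u n i s)
      * \sum_(e in dual_faces s) F n s e * (ue n i e - u n i s).

End Scheme.
End Mesh.

(* Main.v *)
Require Import Defs.
From mathcomp Require Import all_boot all_order all_algebra.
From mathcomp Require Import all_classical all_reals all_analysis.
From mathcomp Require Import ring.
Import Order.TTheory GRing.Theory Num.Theory.
Local Open Scope ring_scope.

(** This is the discrete counterpart of multiplying the momentum balance by the
velocity to get the kinetic energy balance. Write [D] for the measure of the
dual cell of [s], [r'] for its density at time [n+1], and [a], [b] for the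
velocity [u s] at times [n+1] and [n].

Subtracting [b] times the mass balance from the convection operator puts it in
non-conservative form, [D * C = D / dt * r' * (a - b) + \sum F * (ue - b)]
([convection_nonconservative]). Multiply this by [a]. The time increment obeys
[a * (a - b) = (a ^+ 2 - b ^+ 2 + (a - b) ^+ 2) / 2], whose square is the first
part of the remainder. The flux sum contains the increments [ue - b], relative
to the velocity [b] at time [n]; multiplied by [b], they become differences
of squares, [b * (ue - b) = (ue ^+ 2 - b ^+ 2 - (ue - b) ^+ 2) / 2]
([sum_flux_kinetic]); splitting [a = b + (a - b)] leaves the second part of the
remainder. Finally the two terms in [b ^+ 2] still carry [r'] and [\sum F]; the
mass balance, used a second time, merges them into the kinetic energy at time
[n], of density [rhoD n s]. *)

(** The dual mass balance times the velocity at time [n] is exactly what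
separates the conservative from the non-conservative form. *)
Lemma convection_nonconservative (R : realType) (d : nat) (M : mesh_data R d)
    (dt : R) (rhoD : nat -> face M -> R) (u : nat -> 'I_d -> face M -> R)
    (F : nat -> face M -> dual_face M -> R)
    (ue : nat -> 'I_d -> dual_face M -> R) (n : nat) (i : 'I_d) (s : face M) :
  dual_vol s != 0 -> dual_mass_balance dt rhoD F n s ->
  dual_vol s * convection dt rhoD u F ue n i s =
    dual_vol s / dt * rhoD n.+1 s * (u n.+1 i s - u n i s)
    + \sum_(e in dual_faces s) F n s e * (ue n i e - u n i s).
Proof.
rewrite /dual_mass_balance /convection => D0 mass.
have -> : \sum_(e in dual_faces s) F n s e * (ue n i e - u n i s) =
    \sum_(e in dual_faces s) F n s e * ue n i e
    - (\sum_(e in dual_faces s) F n s e) * u n i s.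
  by rewrite mulr_suml -sumrB; apply: eq_bigr => e _; rewrite mulrBr.
move/eqP: mass; rewrite addrC addr_eq0 => /eqP ->.
by rewrite mulrDr mulVKf //; ring.
Qed.

(** The quadratic identity behind upwinding estimates: transporting [v e] with
the flux [F e] and testing with the cell value [b] gives the flux of the
kinetic energy, up to squares of the jumps [v e - b]. *)
Lemma sum_flux_kinetic (R : numFieldType) (I : finType) (A : {set I})
    (F v : I -> R) (b : R) :
  b * (\sum_(e in A) F e * (v e - b)) =
    2^-1 * (\sum_(e in A) F e * v e ^+ 2)
    - 2^-1 * b ^+ 2 * (\sum_(e in A) F e)
    + \sum_(e in A) - 2^-1 * F e * (v e - b) ^+ 2.
Proof.
rewrite !mulr_sumr -sumrB -big_split /=.
by apply: eq_bigr => e _; field.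
Qed.

Theorem lemma4p1 (R : realType) (d : nat) (d23 : d = 2%N \/ d = 3%N)
    (M : mesh_data R d) (meshM : is_mesh M)
    (tf dt : R) (N : nat) (dtE : dt = tf / N%:R) (dt_gt0 : 0 < dt)
    (rho : nat -> cell M -> R)
    (rho_gt0 : forall n K, (n <= N)%N -> 0 < rho n K)
    (rhoD : nat -> face M -> R)
    (rhoDE : forall n, (n <= N)%N -> is_face_density (rho n) (rhoD n))
    (u : nat -> 'I_d -> face M -> R)
    (F : nat -> face M -> dual_face M -> R)
    (ue : nat -> 'I_d -> dual_face M -> R)
    (mass : forall s n, (n < N)%N -> dual_mass_balance dt rhoD F n s) :
  forall (i : 'I_d) (s : face M) (n : nat), (n < N)%N ->
  dual_vol s * u n.+1 i s * convection dt rhoD u F ue n i s =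
    dual_vol s / (2 * dt)
      * (rhoD n.+1 s * u n.+1 i s ^+ 2 - rhoD n s * u n i s ^+ 2)
    + 2^-1 * (\sum_(e in dual_faces s) F n s e * ue n i e ^+ 2)
    + (\sum_(e in dual_faces s) flux_remainder u F ue n i s e)
    + time_remainder dt rhoD u F ue n i s.
Proof.
move=> i s n ltnN; have bal := mass s n ltnN.
have dt0 : dt != 0 by rewrite gt_eqF.
have D0 : dual_vol s != 0 by rewrite gt_eqF // (dual_vol_gt0 meshM).
rewrite mulrAC convection_nonconservative //.
have := sum_flux_kinetic R _ (dual_faces s) (F n s) (ue n i) (u n i s).
rewrite /time_remainder /flux_remainder.
set J := \sum_(e in _) F n s e * (_ - _).
set Q := \sum_(e in _) - 2^-1 * _ * _; set E := \sum_(e in _) _ * _ ^+ 2.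
move: bal; rewrite /dual_mass_balance addrC => /eqP; rewrite addr_eq0 => /eqP ->.
move=> bJ.
(* The sum of squared jumps is eliminated through [bJ]; what remains is the
   polarization identity for the time increment. *)
have -> : Q = u n i s * J - 2^-1 * E
    - 2^-1 * u n i s ^+ 2 * (dual_vol s / dt * (rhoD n.+1 s - rhoD n s)).
  by rewrite bJ; ring.
by field.
Qed.
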